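(* Let $d$ be prime, $n\ge1$, $G$ invertible over $\mathbb Z_d$, and $\rho_A,\rho_B$ $n$-qudit states. (1) If $G$ is odd-parity positive, $J(\rho_A\boxtimes\rho_B)\le J(\rho_B)$. (2) If $G$ is even-parity positive, $J(\rho_A\boxtimes\rho_B)\le J(\rho_A)$. (3) If $G$ is positive, $J(\rho_A\boxtimes\rho_B)\le\min\{J(\rho_A),J(\rho_B)\}$.
   Context: Fix a prime $d$; $\chi(k)=e^{2\pi ik/d}$, Pauli operators $X|k\rangle=|k+1\rangle$, $Z|k\rangle=\chi(k)|k\rangle$ on $\mathbb C^d$; $X_k,Z_k$ act on the $k$-th of $n$ qudits. For $R\in\{X_k,Z_k\}$ let $|j\rangle_R$ be the eigenvector of $R$ with eigenvalue $\chi(j)$, $H^R_j=|j\rangle\langle j|_R$, and $\Delta_R(\rho)=\sum_j{}_R\langle j|\rho|j\rangle_R\,|j\rangle\langle j|_R$. For a Hermitian $H$, $J(\rho;H)=\mathrm{Tr}[\rho[H,[H,\log\rho]]]$, and $J(\rho)=\sum_{k=1}^n\sum_{j}\big(J(\rho;H^{X_k}_j)+J(\rho;H^{Z_k}_j)\big)$; equivalently $J(\rho)=2\sum_{k=1}^n\sum_{R\in\{X_k,Z_k\}}\big(D(\rho\|\Delta_R\rho)+D(\Delta_R\rho\|\rho)\big)$ with $D$ the Umegaki relative entropy (possibly $+\infty$), which is used as the definition for non-faithful $\rho$. $G=\begin{pmatrix}g_{00}&g_{01}\\ g_{10}&g_{11}\end{pmatrix}$ over $\mathbb Z_d$, $\det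 G\not\equiv 0$, $N=(\det G)^{-1}$; nontrivial if at most one entry is $0$ mod $d$; odd-parity positive if nontrivial and $g_{01},g_{10}\not\equiv0$; even-parity positive if nontrivial and $g_{00},g_{11}\not\equiv0$; positive if both. Key unitary $U|\vec i\rangle|\vec j\rangle=|Ng_{11}\vec i-Ng_{10}\vec j\rangle|-Ng_{01}\vec i+Ng_{00}\vec j\rangle$; $\rho\boxtimes\sigma=\mathrm{Tr}_B[U(\rho\otimes\sigma)U^\dagger]$. *)

(* Defs.v *)
From HB Require Import structures.
From mathcomp Require Import all_boot all_order all_algebra.
From mathcomp Require Import all_classical all_reals all_analysis.
From mathcomp Require Import complex.
From Stdlib Require Import ClassicalEpsilon.

Set Implicit Arguments.
Unset Strict Implicit.
Unset Printing Implicit Defensive.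

Import Order.TTheory GRing.Theory Num.Theory.
Local Open Scope ring_scope.
Local Open Scope complex_scope.

Section Operators.
Variable R : realType.
Local Notation C := R[i].

Definition op (T : finType) := T -> T -> C.

Variable T S : finType.

Definition mulop (A B : op T) : op T := fun x y => \sum_(z : T) A x z * B z y.
Definition trace (A : op T) : C := \sum_(x : T) A x x.
Definition adj (A : op T) : op T := fun x y => (A y x)^*.
Definition hermitian (A : op T) : Prop := forall x y, A x y = (A y x)^*.
Definition psd (A : op T) : Prop :=
  hermitian A /\
  forall v : T -> C, 0 <= \sum_(x : T) \sum_(y : T) (v x)^* * A x y * v y.
Definition is_state (rho : op T) : Prop := psd rho /\ trace rho = 1.

Definition tensor (A : op T) (B : op S) : op (T * S)%type :=
  fun u v => A u.1 v.1 * B u.2 v.2.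
Definition ptrace2 (M : op (T * S)%type) : op T :=
  fun x y => \sum_(b : S) M (x, b) (y, b).

Definition cdot (u v : T -> C) : C := \sum_(x : T) (u x)^* * v x.
Definition sqnorm (z : C) : R := complex.Re z ^+ 2 + complex.Im z ^+ 2.

Definition orthonormal (e : T -> T -> C) : Prop :=
  forall k l, cdot (e k) (e l) = (k == l)%:R.
Definition spectral_decomp (A : op T) (e : T -> T -> C) (lam : T -> R) : Prop :=
  orthonormal e /\ forall x y, A x y = \sum_(k : T) (lam k)%:C * e k x * (e k y)^*.

(* a chosen spectral decomposition (exists for every Hermitian A) *)
Definition spec (A : op T) : (T -> T -> C) * (T -> R) :=
  epsilon (inhabits ((fun _ _ => 0), (fun _ => 0)))
          (fun p => spectral_decomp A p.1 p.2).

(* contribution of the pair of eigenvectors (e_k, f_l) with overlap w =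
   |<e_k|f_l>|^2 and eigenvalues a (of rho), b (of sigma) to
   Tr rho log rho - Tr rho log sigma; +oo when supp rho is not inside supp sigma *)
Definition relent_term (w a b : R) : \bar R :=
  if (w == 0) || (a <= 0) then 0%E
  else if b <= 0 then +oo%E
  else (w * a * (ln a - ln b))%:E.

(* Umegaki relative entropy D(rho || sigma) = Tr rho (log rho - log sigma),
   +oo if supp rho is not contained in supp sigma, computed through the
   spectral decompositions of rho and sigma (with 0 log 0 = 0). *)
Definition relent (rho sigma : op T) : \bar R :=
  let: (e, a) := spec rho in
  let: (f, b) := spec sigma in
  (\sum_(k : T) \sum_(l : T) relent_term (sqnorm (cdot (e k) (f l))) (a k) (b l))%E.

End Operators.

Section Qudits.
Variable R : realType.
Local Notation C := R[i].
Variables d n : nat.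

(* computational basis of (C^d)^{(x)n} indexed by Z_d^n *)
Definition qudit := {ffun 'I_n -> 'Z_d}.

Definition chi (k : 'Z_d) : C :=
  (cos (2 * pi * (val k)%:R / d%:R))%:C + 'i * (sin (2 * pi * (val k)%:R / d%:R))%:C.

Definition pauliX : op R 'Z_d := fun x y => (x == y + 1)%:R.
Definition pauliZ : op R 'Z_d := fun x y => (x == y)%:R * chi y.

Inductive pauli := PX | PZ.

(* |j>_R : eigenvector of R with eigenvalue chi(j) (as a function of the
   computational index) *)
Definition eigket (P : pauli) (j : 'Z_d) : 'Z_d -> C :=
  match P with
  | PZ => fun x => (x == j)%:R
  | PX => fun x => ((Num.sqrt (d%:R : R))^-1)%:C * chi (- (j * x))
  end.

(* H^{R_k}_j = |j><j|_R acting on the k-th qudit (identity on the others) *)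
Definition Hproj (P : pauli) (k : 'I_n) (j : 'Z_d) : op R qudit :=
  fun x y => ([forall m : 'I_n, (m != k) ==> (x m == y m)])%:R
             * eigket P j (x k) * (eigket P j (y k))^*.

(* Delta_{R_k}(rho) = sum_j <j|rho|j>_R |j><j|_R = sum_j H_j rho H_j *)
Definition dephase (P : pauli) (k : 'I_n) (rho : op R qudit) : op R qudit :=
  fun x y => \sum_(j : 'Z_d) mulop (mulop (Hproj P k j) rho) (Hproj P k j) x y.

Definition Jfun (rho : op R qudit) : \bar R :=
  (2%:E * \sum_(k < n)
     ((relent rho (dephase PX k rho) + relent (dephase PX k rho) rho)
    + (relent rho (dephase PZ k rho) + relent (dephase PZ k rho) rho)))%E.

Variable G : 'M['Z_d]_2.
Definition g00 := G ord0 ord0.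
Definition g01 := G ord0 ord_max.
Definition g10 := G ord_max ord0.
Definition g11 := G ord_max ord_max.
Definition Ninv : 'Z_d := (\det G)^-1.

Definition keymap (v : qudit * qudit) : qudit * qudit :=
  ([ffun m => Ninv * g11 * v.1 m - Ninv * g10 * v.2 m],
   [ffun m => - (Ninv * g01) * v.1 m + Ninv * g00 * v.2 m]).
Definition keyU : op R (qudit * qudit)%type :=
  fun u v => (u == keymap v)%:R.

Definition boxconv (rho sigma : op R qudit) : op R qudit :=
  ptrace2 (mulop (mulop keyU (tensor rho sigma)) (adj keyU)).

Definition nontrivialG : bool :=
  (#|[set ij : 'I_2 * 'I_2 | G ij.1 ij.2 == 0%R]| <= 1)%N.
Definition odd_parity_positive : bool := [&& nontrivialG, g01 != 0%R & g10 != 0%R].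
Definition even_parity_positive : bool := [&& nontrivialG, g00 != 0%R & g11 != 0%R].
Definition positiveG : bool := odd_parity_positive && even_parity_positive.

End Qudits.

(* Main.v *)
Require Import Defs.
From HB Require Import structures.
From mathcomp Require Import all_boot all_order all_algebra.
From mathcomp Require Import all_classical all_reals all_analysis.
From mathcomp Require Import complex.
From mathcomp Require Import perm ring lra.
From Stdlib Require Import ClassicalEpsilon.
Import Order.TTheory GRing.Theory Num.Theory.
Import numFieldNormedType.Exports.
Local Open Scope ring_scope.

(** With [x_s = s a + (1 - s) b], the integrand of
    [a (ln a - ln b) - a + b = \int_0^1 (1 - s) (a - b)^2 / x_s ds]
    reduces monotonicity of the Umegaki relative entropy under a channel to that of the
    quadratic divergences [\sum_(k, l) |<e_k|f_l>|^2 (a_k - b_l)^2 / (s a_k + (1 - s) b_l)].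
    Such a divergence is the supremum over [X] of
    [2 Re Tr X^* (A - B) - s Tr X^* A X - (1 - s) Tr X B X^*],
    and replacing [X] by its image under the dual channel only increases this expression, by the
    Kadison-Schwarz inequality. No integral is needed: the integrated inequality is a comparison
    of derivatives in [s], and [s -> 0] also accounts for infinite relative entropies.

    The convolution [sigma |-> rho [x] sigma] is a channel, and it commutes with the dephasing
    maps [Delta_(X_k)] when [g10 != 0] and [Delta_(Z_k)] when [g01 != 0]: conjugating the second
    input by a shift or a phase of the k-th qudit conjugates the output by a shift or a phase.
    Hence each relative entropy in [J] decreases. Exchanging the columns of [G] exchanges the two
    inputs, which turns the even-parity case into the odd-parity one. *)

Set Implicit Arguments.
Unset Strict Implicit.
Unset Printing Implicit Defensive.

(** * From quadratic divergences to relative entropy: scalar inequalities *)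

Section Mix.
Context {K : fieldType}.

Definition mix (s a b : K) : K := s * a + (1 - s) * b.
(** Stated over any field so as to apply both to real eigenvalues and to their complex embeddings.
    At [a = b = 0] the convention [0 / 0 = 0] gives the value that the derivative of [gap]
    requires. *)
Definition chi2 (s a b : K) : K := (a - b) ^+ 2 / mix s a b.

End Mix.

Section Scalar.
Context {R : realType}.
Implicit Types a b s w x y : R.

(** For [0 < s] and [a], [b] nonnegative, this is the closed form of the integral of
    [(1 - t) * chi2 t a b] over [t] from [s] to [1]. *)
Definition gap s a b : R := a * (ln a - ln (mix s a b)) - a + mix s a b.

Lemma mix_gt0l {s a b} : 0 < s -> s <= 1 -> 0 < a -> 0 <= b -> 0 < mix s a b.
Proof. rewrite /mix => s0 s1 a0 b0; nra. Qed.

Lemma mix_gt0r {s a b} : 0 <= s -> s < 1 -> 0 <= a -> 0 < b -> 0 < mix s a b.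
Proof. rewrite /mix => s0 s1 a0 b0; nra. Qed.

Lemma mix_ge0 {s a b} : 0 <= s -> s <= 1 -> 0 <= a -> 0 <= b -> 0 <= mix s a b.
Proof. rewrite /mix => s0 s1 a0 b0; nra. Qed.

Lemma mix0 a b : mix 0 a b = b. Proof. by rewrite /mix; ring. Qed.
Lemma mix1 a b : mix 1 a b = a. Proof. by rewrite /mix; ring. Qed.

Lemma gap1 a b : gap 1 a b = 0.
Proof. by rewrite /gap mix1; ring. Qed.

Lemma ln_tangent x y : 0 < x -> 0 < y -> ln y - ln x <= y / x - 1.
Proof.
move=> x0 y0; rewrite -ln_div ?posrE//.
have xy : 0 < y / x by rewrite divr_gt0.
by have := @le_ln1Dx R (y / x - 1); rewrite addrCA subrr addr0; apply; lra.
Qed.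

Lemma ln_tangentM x y : 0 < x -> 0 < y -> x * (ln y - ln x) <= y - x.
Proof.
move=> x0 y0; have /(ler_wpM2l (ltW x0)) := ln_tangent x0 y0.
by rewrite [leRHS]mulrBr mulr1 mulrCA divff ?gt_eqF// mulr1.
Qed.

Lemma gap_ge0 {s a b} : 0 < s -> s <= 1 -> 0 <= a -> 0 <= b -> 0 <= gap s a b.
Proof.
move=> s0 s1; rewrite le_eqVlt => /predU1P[<- b0|a0 b0].
  by rewrite /gap mul0r oppr0 !add0r mix_ge0// ltW.
have x0 := mix_gt0l s0 s1 a0 b0.
by have := ln_tangentM a0 x0; rewrite /gap; lra.
Qed.

(** Concavity of [ln] gives [gap s a b <= (1 - s) * gap 0 a b], and [gap 0 a b] is nonnegative. *)
Lemma gap_le_gap0 {s a b} : 0 <= s -> s < 1 -> 0 <= a -> 0 < b ->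
  gap s a b <= gap 0 a b.
Proof.
move=> s0 s1; rewrite le_eqVlt => /predU1P[<- b0|a0 b0].
  by rewrite /gap mix0 /mix; nra.
have x0 := mix_gt0r s0 s1 (ltW a0) b0.
have la := ln_tangent x0 a0; have lb := ln_tangent x0 b0.
have xE : s * (a / mix s a b - 1) + (1 - s) * (b / mix s a b - 1) = 0.
  by move: x0; rewrite /mix => x0; field; rewrite gt_eqF.
have s1' : 0 <= 1 - s by lra.
have := lerD (ler_wpM2l s0 la) (ler_wpM2l s1' lb); rewrite xE => conc.
have ba := ln_tangentM a0 b0.
rewrite /gap mix0 {2}/mix; set lx := ln (mix s a b) in conc *.
by clear -conc ba s0 s1 a0; nra.
Qed.

(** Bounding [ln] by its tangent at [b] costs an error linear in [s]; this is a quantitative form of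
    continuity at [s = 0]. *)
Lemma gap0_le {s a b} : 0 <= s -> s < 1 -> 0 <= a -> 0 < b ->
  gap 0 a b <= gap s a b + s * chi2 0 a b.
Proof.
move=> s0 s1 a0 b0; have x0 := mix_gt0r s0 s1 a0 b0.
have /(ler_wpM2l a0) := ln_tangent b0 x0.
have -> : a * (mix s a b / b - 1) = s * chi2 0 a b + (mix s a b - b).
  by rewrite /chi2 mix0 /mix; field; rewrite gt_eqF.
by rewrite /gap mix0; nra.
Qed.

Lemma is_derive_gap s a b : 0 < s -> s < 1 -> 0 <= a -> 0 <= b ->
  is_derive s 1 (fun t => gap t a b) (- ((1 - s) * chi2 s a b)).
Proof.
move=> s0 s1 a0 b0.
have dmix : is_derive s 1 (fun t : R => mix t a b) (a - b).
  rewrite /mix; apply: is_derive_eq; rewrite /GRing.scale/=; ring.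
move: a0; rewrite le_eqVlt => /predU1P[a0|a0].
  rewrite (_ : (fun t => _) = (fun t : R => mix t a b)); last first.
    by apply/funext => t; rewrite /gap -a0; ring.
  apply: is_derive_eq; rewrite -a0 /chi2 /mix.
  have [->|b1] := eqVneq b 0; first by rewrite !subr0 expr0n/= mul0r mulr0 oppr0.
  by field; rewrite b1/= subr_eq0 gt_eqF.
have x0 := mix_gt0l s0 (ltW s1) a0 b0.
have dln : is_derive s 1 (fun t => ln (mix t a b)) ((mix s a b)^-1 * (a - b)).
  refine (@is_derive1_comp R (@ln R) (fun t : R => mix t a b) s _ _ (is_derive1_ln x0) dmix).
rewrite /gap; apply: is_derive_eq.
rewrite /GRing.scale/= /chi2; move: x0; rewrite /mix => x0.
by field; rewrite gt_eqF.
Qed.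


Lemma continuous_gap s a b : 0 < s -> s <= 1 -> 0 <= a -> 0 <= b ->
  {for s, continuous (fun t => gap t a b)}.
Proof.
move=> s0 s1 a0 b0.
have cmix : {for s, continuous (fun t : R => mix t a b)}.
  apply: differentiable_continuous; apply/derivable1_diffP.
  by apply: ex_derive.
move: a0; rewrite le_eqVlt => /predU1P[a0|a0].
  rewrite (_ : (fun t => _) = (fun t : R => mix t a b))//.
  by apply/funext => t; rewrite /gap -a0; ring.
have cln : {for s, continuous (@ln R \o (fun t : R => mix t a b))}.
  by apply: continuous_comp => //; apply: continuous_ln; exact: mix_gt0l.
rewrite /gap; apply: cvgD => //; apply: cvgB; last exact: cvg_cst.
by apply: cvgM; [exact: cvg_cst|apply: cvgB => //; exact: cvg_cst].
Qed.

(** The correction [u * (p - q)] undoes the terms [- p + q] of [gap 0]. Summed over all pairs of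
    eigenvectors it is a difference of traces, which a channel preserves. The excluded case is the
    one of value [+oo]. *)
Lemma relent_term_gap (u p q : R) : 0 <= p -> 0 <= q -> ~~ [&& u != 0, 0 < p & q == 0] ->
  relent_term u p q = (u * gap 0 p q + u * (p - q))%:E.
Proof.
move=> p0 q0; rewrite /relent_term.
have [->|u0]/= := eqVneq u 0; first by rewrite !mul0r addr0.
move: p0; rewrite le_eqVlt => /predU1P[<-|p0].
  by rewrite lexx /gap mix0 => _; congr _%:E; ring.
rewrite p0 leNgt p0/= => q1; rewrite leNgt lt_neqAle q0 eq_sym q1/= /gap mix0.
by congr _%:E; ring.
Qed.

Lemma relent_term_pinfty (u p q : R) : [&& u != 0, 0 < p & q == 0] -> relent_term u p q = +oo%E.
Proof.
by case/and3P => /negPf u0 p0 /eqP ->; rewrite /relent_term u0 leNgt p0/= lexx.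
Qed.

Lemma relent_termNNy (u p q : R) : relent_term u p q != -oo%E.
Proof. by rewrite /relent_term; case: ifP => // _; case: ifP. Qed.

(** * Comparison of weighted families of eigenvalue pairs *)

Section Family.
Variables (I J : finType) (w a b : I -> R) (w' a' b' : J -> R).
Hypotheses (w0 : forall i, 0 <= w i) (a0 : forall i, 0 <= a i) (b0 : forall i, 0 <= b i).
Hypotheses (w0' : forall j, 0 <= w' j) (a0' : forall j, 0 <= a' j) (b0' : forall j, 0 <= b' j).
Hypothesis chi2_le : forall s, 0 < s < 1 ->
  \sum_j w' j * chi2 s (a' j) (b' j) <= \sum_i w i * chi2 s (a i) (b i).
Hypothesis trace_eq : \sum_j w' j * (a' j - b' j) = \sum_i w i * (a i - b i).

Lemma sum_gap_le s : 0 < s -> s < 1 ->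
  \sum_j w' j * gap s (a' j) (b' j) <= \sum_i w i * gap s (a i) (b i).
Proof.
move=> s0 s1.
(* [H] vanishes at [1], and [chi2_le] makes its derivative nonnegative on []s, 1[], hence
   [H s <= 0]. *)
pose H t := \sum_j w' j * gap t (a' j) (b' j) - \sum_i w i * gap t (a i) (b i).
suff : H s <= H 1.
  have H1 : H 1 = 0.
    rewrite /H big1 ?sub0r ?big1 ?oppr0// => i _; by rewrite gap1 mulr0.
  by rewrite H1 /H subr_le0.
have dH t : t \in `]s, 1[ -> is_derive t 1 H
    (\sum_j w' j * - ((1 - t) * chi2 t (a' j) (b' j))
     - \sum_i w i * - ((1 - t) * chi2 t (a i) (b i))).
  rewrite in_itv/= => /andP[st t1]; have t0 := lt_trans s0 st.
  have dg (K : finType) (v p q : K -> R) : (forall i, 0 <= p i) -> (forall i, 0 <= q i) ->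
      is_derive t 1 (fun t => \sum_i v i * gap t (p i) (q i))
        (\sum_i v i * - ((1 - t) * chi2 t (p i) (q i))).
    move=> p0 q0.
    rewrite (_ : (fun _ => _) = \sum_i (v i \*: fun t => gap t (p i) (q i))); last first.
      by apply/funext => u; rewrite fct_sumE.
    elim/big_ind2 : _ => [|f df g dg|i _]; [exact: is_derive_cst|exact: is_deriveD|].
    by apply: is_deriveZ; exact: is_derive_gap.
  by apply: is_deriveB; apply: dg.
apply: (@ger0_derive1_ndecr _ H s 1) => //; last exact: ltW.
- by move=> t /dH dHt; apply: ex_derive.
- move=> t t01; rewrite derive1E (@derive_val _ _ _ _ _ _ _ (dH _ t01)).
  have := chi2_le; move: t01; rewrite in_itv/= => /andP[st t1] /(_ t).
  rewrite (lt_trans s0 st) t1 => /(_ isT).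
  rewrite -subr_ge0 => chi.
  have sE (K : finType) (v f : K -> R) :
      \sum_i v i * - ((1 - t) * f i) = - ((1 - t) * \sum_i v i * f i).
    by rewrite mulr_sumr -sumrN; apply: eq_bigr => i _; ring.
  rewrite !sE opprK addrC -mulrBr mulr_ge0// subr_ge0 ltW//.
apply: continuous_in_subspaceT => t; rewrite inE/= in_itv/= => /andP[st t1].
have t0 := lt_le_trans s0 st.
have cg (K : finType) (v p q : K -> R) : (forall i, 0 <= p i) -> (forall i, 0 <= q i) ->
    {for t, continuous (fun t => \sum_i v i * gap t (p i) (q i))}.
  move=> p0 q0; apply: cvg_big => [|i _]; first exact: add_continuous.
  by apply: cvgM; [exact: cvg_cst|exact: continuous_gap].
by apply: cvgB; apply: cg.
Qed.

Let bad i := [&& w i != 0, 0 < a i & b i == 0].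
Let bad' j := [&& w' j != 0, 0 < a' j & b' j == 0].

(** An infinite term on the right leaves nothing to prove. Otherwise [M] bounds the primed gap sums
    for all [0 < s < 1]. As [s] tends to [0], a bad primed index would contribute a multiple of
    [- ln s], so there is none; the bound then extends to [s = 0] with the linear error of
    [gap0_le]. *)
Lemma sum_relent_term_le :
  (\sum_j relent_term (w' j) (a' j) (b' j) <= \sum_i relent_term (w i) (a i) (b i))%E.
Proof.
have [/existsP[i bi]|/existsPn nb] := boolP [exists i, bad i].
  suff -> : (\sum_i relent_term (w i) (a i) (b i) = +oo)%E by rewrite leey.
  apply/eqP; rewrite esum_eqy; last by move=> *; exact: relent_termNNy.
  by apply/existsP; exists i; rewrite relent_term_pinfty ?eqxx.
rewrite (eq_bigr _ (fun i _ => relent_term_gap (a0 i) (b0 i) (nb i))) sumEFin.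
rewrite big_split/= -trace_eq.
set M := \sum_i w i * gap 0 _ _.
have gap_le_M s : 0 < s -> s < 1 -> \sum_j w' j * gap s (a' j) (b' j) <= M.
  move=> s0 s1; apply: le_trans (sum_gap_le s0 s1) _.
  apply: ler_sum => i _; have := nb i; rewrite /bad.
  have [->|wi]/= := eqVneq (w i) 0; first by rewrite !mul0r.
  have := a0 i; rewrite le_eqVlt => /predU1P[<- _|ai].
    by rewrite ler_wpM2l// /gap mix0 /mix; have := b0 i; nra.
  rewrite ai/= => bi; rewrite ler_wpM2l// gap_le_gap0// ?ltW//.
  by rewrite lt_neqAle eq_sym bi b0.
have [/existsP[j]|/existsPn nb'] := boolP [exists j, bad' j].
  case/and3P=> wj aj /eqP bj; exfalso.
  have wj0 : 0 < w' j by rewrite lt_neqAle eq_sym wj w0'.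
  (* With [b' j = 0] the [j]-th term is [w' j * a' j * (- ln s - 1 + s)]; this [s] makes it exceed
     [|M| + w' j * a' j], hence [M]. *)
  pose s := expR (- (`|M| / (w' j * a' j) + 2)).
  have s0 : 0 < s := expR_gt0 _.
  have wa0 : 0 < w' j * a' j by rewrite mulr_gt0.
  have Mge0 : 0 <= `|M| / (w' j * a' j) by rewrite divr_ge0// ltW.
  have s1 : s < 1 by rewrite /s expR_lt1; lra.
  have := gap_le_M s s0 s1; rewrite (bigD1 j)//=.
  have : 0 <= \sum_(i | i != j) w' i * gap s (a' i) (b' i).
    by apply: sumr_ge0 => i _; rewrite mulr_ge0// gap_ge0// ltW.
  have -> : w' j * gap s (a' j) (b' j) = w' j * a' j * (- ln s - 1) + w' j * a' j * s.
    rewrite /gap bj /mix mulr0 addr0 lnM ?posrE//; ring.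
  have -> : w' j * a' j * (- ln s - 1) = `|M| + w' j * a' j.
    by rewrite /s expRK; field; rewrite ?wj ?gt_eqF.
  by have := ler_norm M; nra.
rewrite (eq_bigr _ (fun j _ => relent_term_gap (a0' j) (b0' j) (nb' j))) sumEFin.
rewrite big_split/= lee_fin lerD2r leNgt; apply/negP.
set D := \sum_j w' j * gap 0 _ _ => MD.
pose K := \sum_j w' j * chi2 0 (a' j) (b' j).
have K0 : 0 <= K.
  apply: sumr_ge0 => j _; rewrite mulr_ge0// /chi2 mix0 divr_ge0//.
  by rewrite sqr_ge0.
have DK s : 0 < s -> s < 1 -> D <= M + s * K.
  move=> s0 s1; apply: le_trans (lerD (gap_le_M s s0 s1) (lexx _)).
  rewrite mulr_sumr -big_split/=; apply: ler_sum => j _.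
  have := nb' j; rewrite /bad'.
  have [->|wj]/= := eqVneq (w' j) 0; first by rewrite !mul0r mulr0 addr0.
  move=> bj; rewrite mulrCA -mulrDr ler_wpM2l//; move: bj.
  have := a0' j; rewrite le_eqVlt => /predU1P[<- _|aj].
    have [->|bj] := eqVneq (b' j) 0.
      by rewrite /gap /chi2 /mix !(mul0r, mulr0, addr0, subr0, invr0, oppr0).
    by apply: gap0_le => //; rewrite ?ltW// lt_neqAle eq_sym bj b0'.
  rewrite aj/= => bj; apply: gap0_le => //; rewrite ?ltW//.
  by rewrite lt_neqAle eq_sym bj b0'.
(* Small enough that [s * K] stays below half of [D - M], against [D <= M + s * K]; the summands
   [D - M] and [1] of the denominator ensure [s < 1] and positivity. *)
pose s := (D - M) / (2 * (K + (D - M) + 1)).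
have den : 0 < 2 * (K + (D - M) + 1) by lra.
have s0 : 0 < s by rewrite divr_gt0//; lra.
have s1 : s < 1 by rewrite ltr_pdivrMr//; lra.
have := DK s s0 s1; have sE : s * (2 * (K + (D - M) + 1)) = D - M.
  by rewrite divfK// gt_eqF.
by clear -sE s0 s1 K0 MD; nra.
Qed.

End Family.
End Scalar.

(** * Quadratic divergences of matrices *)

Section Matrix.
Local Open Scope sesquilinear_scope.
Context {C : numClosedFieldType}.

Lemma adjmxM m n p (A : 'M[C]_(m, n)) (B : 'M[C]_(n, p)) :
  (A *m B)^t* = B^t* *m A^t*.
Proof. by rewrite trmx_mul map_mxM. Qed.

Lemma adjmxB m n (A B : 'M[C]_(m, n)) : (A - B)^t* = A^t* - B^t*.
Proof. by rewrite linearB map_mxB. Qed.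

Lemma adjmx_sum m n (I : finType) (A : I -> 'M[C]_(m, n)) :
  (\sum_i A i)^t* = \sum_i (A i)^t*.
Proof. by rewrite linear_sum -map_mx_sum. Qed.

Definition spectral_mx n (A E : 'M[C]_n) (a : 'rV[C]_n) :=
  E \is unitarymx /\ A = E *m diag_mx a *m E^t*.

Lemma mxtrace_adj_diag m n (Y W : 'M[C]_(m, n)) a :
  \tr (Y^t* *m diag_mx a *m W) = \sum_k \sum_l (Y k l)^* * a 0 k * W k l.
Proof.
rewrite exchange_big; apply: eq_bigr => l _; rewrite mxE.
by apply: eq_bigr => k _; rewrite mul_mx_diag !mxE.
Qed.

Lemma mxtrace_mul_diag m n (Y W : 'M[C]_(m, n)) b :
  \tr (Y^t* *m W *m diag_mx b) = \sum_k \sum_l (Y k l)^* * W k l * b 0 l.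
Proof.
rewrite exchange_big; apply: eq_bigr => l _; rewrite mul_mx_diag !mxE mulr_suml.
by apply: eq_bigr => k _; rewrite !mxE.
Qed.

Lemma mxtrace_psd_ge0 m n (A E : 'M[C]_n) (a : 'rV[C]_n) (M : 'M[C]_(m, n)) :
  spectral_mx A E a -> (forall k, 0 <= a 0 k) -> 0 <= \tr (M *m A *m M^t*).
Proof.
move=> [_ ->] a0.
have -> : M *m (E *m diag_mx a *m E^t*) *m M^t* = (((M *m E)^t*)^t* *m diag_mx a *m (M *m E)^t*).
  by rewrite trmxCK adjmxM !mulmxA.
rewrite mxtrace_adj_diag; apply: sumr_ge0 => k _; apply: sumr_ge0 => l _.
rewrite mulrAC mulr_ge0//.
by rewrite mulrC mul_conjC_ge0.
Qed.

(** The variational functional of the quadratic divergence, with twice the real part written as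
    [z + z^*] so as to remain in [C]. *)
Definition chi2_form n s (A B X : 'M[C]_n) : C :=
  let z := \tr (X^t* *m (A - B)) in
  z + z^* - s * \tr (X^t* *m A *m X) - (1 - s) * \tr (X *m B *m X^t*).

Definition overlap n (E F : 'M[C]_n) k l : C := `|(E^t* *m F) k l| ^+ 2.

(** Written in the eigenbases of [A] and [B], the functional decouples into independent scalar
    quadratics, one for each entry [Y k l]. *)
Lemma chi2_formE n s (A B E F Y : 'M[C]_n) (a b : 'rV[C]_n) :
  spectral_mx A E a -> spectral_mx B F b ->
  chi2_form s A B (E *m Y *m F^t*) =
  \sum_k \sum_l (let z := (Y k l)^* * (a 0 k - b 0 l) * (E^t* *m F) k l in
     z + z^* - mix s (a 0 k) (b 0 l) * (Y k l * (Y k l)^*)).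
Proof.
move=> [uE ->] [uF ->]; have /unitarymxP EE := uE; have /unitarymxP FF := uF.
have {}EE := mulmx1C EE; have {}FF := mulmx1C FF.
set W := E^t* *m F.
set X := E *m Y *m F^t*.
have XE : X^t* = F *m Y^t* *m E^t* by rewrite !adjmxM trmxCK mulmxA.
have t1 : \tr (X^t* *m (E *m diag_mx a *m E^t*)) = \sum_k \sum_l (Y k l)^* * a 0 k * W k l.
  rewrite XE !mulmxA -(mulmxA _ (E^t*) E) EE mulmx1 -mxtrace_adj_diag.
  by rewrite -!mulmxA mxtrace_mulC !mulmxA.
have t2 : \tr (X^t* *m (F *m diag_mx b *m F^t*)) = \sum_k \sum_l (Y k l)^* * W k l * b 0 l.
  rewrite XE !mulmxA mxtrace_mulC !mulmxA FF mul1mx -(mulmxA _ (E^t*) F) -/W.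
  exact: mxtrace_mul_diag.
have t3 : \tr (X^t* *m (E *m diag_mx a *m E^t*) *m X) = \sum_k \sum_l (Y k l)^* * a 0 k * Y k l.
  rewrite XE /X !mulmxA -(mulmxA _ (E^t*) E) EE mulmx1 -(mulmxA _ (E^t*) E) EE mulmx1.
  by rewrite mxtrace_mulC !mulmxA FF mul1mx mxtrace_adj_diag.
have t4 : \tr (X *m (F *m diag_mx b *m F^t*) *m X^t*) = \sum_k \sum_l (Y k l)^* * Y k l * b 0 l.
  rewrite XE /X !mulmxA -(mulmxA _ (F^t*) F) FF mulmx1 -(mulmxA _ (F^t*) F) FF mulmx1.
  rewrite mxtrace_mulC !mulmxA EE mul1mx mxtrace_mulC mulmxA.
  exact: mxtrace_mul_diag.
rewrite /chi2_form mulmxBr linearB/= t3 t4 t1 t2 -sumrB rmorph_sum/= -big_split/=.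
rewrite !mulr_sumr -!sumrB; apply: eq_bigr => k _.
rewrite -sumrB rmorph_sum/= -big_split/= !mulr_sumr -!sumrB; apply: eq_bigr => l _.
rewrite !(rmorphM, rmorphB)/= /mix.
ring.
Qed.

Lemma mix_ge0_eq0 (s a b : C) : 0 < s < 1 -> 0 <= a -> 0 <= b ->
  0 <= mix s a b /\ (mix s a b = 0 -> a - b = 0).
Proof.
move=> /andP[s0 s1] a0 b0; have s1' : 0 < 1 - s by rewrite subr_gt0.
have sa : 0 <= s * a by rewrite mulr_ge0// ltW.
have sb : 0 <= (1 - s) * b by rewrite mulr_ge0// ltW.
split; first exact: addr_ge0.
move/eqP; rewrite paddr_eq0// !mulf_eq0 (gt_eqF s0) (gt_eqF s1')/= => /andP[/eqP-> /eqP->].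
by rewrite subr0.
Qed.

(* Completing the square: the difference of the two sides is [|delta w - c y|^2 / c]. *)
Lemma quadratic_le (c delta y w : C) : 0 <= c -> delta \is Num.real -> (c = 0 -> delta = 0) ->
  y^* * delta * w + (y^* * delta * w)^* - c * (y * y^*) <= `|w| ^+ 2 * (delta ^+ 2 / c).
Proof.
move=> c0 /CrealP dR cd; rewrite !rmorphM/= conjCK dR.
have [c1|c1] := eqVneq c 0.
  by rewrite (cd c1) c1 !(mulr0, mul0r, expr0n)/= addr0 subr0.
have /CrealP cR := ger0_real c0.
rewrite -subr_ge0.
have -> : `|w| ^+ 2 * (delta ^+ 2 / c) - (y^* * delta * w + y * delta * w^* - c * (y * y^*)) =
    c^-1 * ((delta * w - c * y) * (delta * w - c * y)^*).
  by rewrite normCK rmorphB !rmorphM/= dR cR; field.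
by rewrite mulr_ge0 ?invr_ge0// mul_conjC_ge0.
Qed.

(** The maximizer is the point where the completed square vanishes, [delta * w = c * y]; for [c = 0]
    everything is zero. *)
Lemma quadratic_attained (c delta w : C) : 0 <= c -> delta \is Num.real -> (c = 0 -> delta = 0) ->
  let y := delta / c * w in
  y^* * delta * w + (y^* * delta * w)^* - c * (y * y^*) = `|w| ^+ 2 * (delta ^+ 2 / c).
Proof.
move=> c0 /CrealP dR cd /=.
have [c1|c1] := eqVneq c 0.
  by rewrite (cd c1) c1 !(mulr0, mul0r, expr0n, rmorph0)/= addr0 subr0.
have /CrealP cR := ger0_real c0.
by rewrite !rmorphM/= !fmorphV/= !conjCK cR dR normCK; field.
Qed.

Lemma chi2_form_le n (s : C) (A B E F X : 'M[C]_n) (a b : 'rV[C]_n) : 0 < s < 1 ->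
  (forall k, 0 <= a 0 k) -> (forall k, 0 <= b 0 k) ->
  spectral_mx A E a -> spectral_mx B F b ->
  chi2_form s A B X <= (\sum_k \sum_l overlap E F k l * chi2 s (a 0 k) (b 0 l)).
Proof.
move=> s01 a0 b0 sA sB.
have [/unitarymxP EE _] := sA; have [/unitarymxP FF _] := sB.
have -> : X = E *m (E^t* *m X *m F) *m F^t*.
  by rewrite !mulmxA EE mul1mx -mulmxA FF mulmx1.
set Y := _ *m _ *m F; rewrite (chi2_formE s Y sA sB).
apply: ler_sum => k _; apply: ler_sum => l _.
have [m0 m1] := mix_ge0_eq0 s01 (a0 k) (b0 l).
by apply: quadratic_le => //; rewrite rpredB// ger0_real.
Qed.

Lemma chi2_form_attained n s (A B E F : 'M[C]_n) (a b : 'rV[C]_n) : 0 < s < 1 ->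
  (forall k, 0 <= a 0 k) -> (forall k, 0 <= b 0 k) ->
  spectral_mx A E a -> spectral_mx B F b ->
  exists X, chi2_form s A B X = (\sum_k \sum_l overlap E F k l * chi2 s (a 0 k) (b 0 l)).
Proof.
move=> s01 a0 b0 sA sB.
(* Each entry is the maximizer of its own scalar quadratic. *)
pose Y := \matrix_(k, l) ((a 0 k - b 0 l) / mix s (a 0 k) (b 0 l) * (E^t* *m F) k l).
exists (E *m Y *m F^t*).
rewrite (chi2_formE _ _ sA sB).
apply: eq_bigr => k _; apply: eq_bigr => l _.
have [m0 m1] := mix_ge0_eq0 s01 (a0 k) (b0 l).
have -> : Y k l = (a 0 k - b 0 l) / mix s (a 0 k) (b 0 l) * (E^t* *m F) k l by rewrite mxE.
by apply: quadratic_attained => //; rewrite rpredB// ger0_real.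
Qed.

(** * Channels in Kraus form and their duals *)

Section Channel.
Variables (m p : nat) (I : finType) (K : I -> 'M[C]_(p, m)).
Hypothesis KK : \sum_i (K i)^t* *m K i = 1%:M.

Definition kraus_mx (A : 'M[C]_m) := \sum_i K i *m A *m (K i)^t*.
Definition kraus_dual (X : 'M[C]_p) := \sum_i (K i)^t* *m X *m K i.

Lemma kraus_dual_adj X : kraus_dual (X^t*) = (kraus_dual X)^t*.
Proof.
rewrite /kraus_dual adjmx_sum; apply: eq_bigr => i _.
by rewrite !adjmxM trmxCK mulmxA.
Qed.

Lemma mxtrace_kraus X A : \tr (X *m kraus_mx A) = \tr (kraus_dual X *m A).
Proof.
rewrite mulmx_sumr mulmx_suml !linear_sum; apply: eq_bigr => i _ /=.
by rewrite -!mulmxA mxtrace_mulC -!mulmxA mxtrace_mulC -!mulmxA mxtrace_mulC -!mulmxA.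
Qed.

Lemma kadison_schwarz A E (a : 'rV[C]_m) X : spectral_mx A E a -> (forall k, 0 <= a 0 k) ->
  \tr (kraus_dual X *m A *m (kraus_dual X)^t*) <= \tr (X *m kraus_mx A *m X^t*).
Proof.
move=> sA a0; set S := kraus_dual X; rewrite -subr_ge0.
suff -> : \tr (X *m kraus_mx A *m X^t*) - \tr (S *m A *m S^t*) =
  \sum_i \tr ((X *m K i - K i *m S) *m A *m (X *m K i - K i *m S)^t*).
  by apply: sumr_ge0 => i _; exact: mxtrace_psd_ge0 sA a0.
pose t1 i := \tr (X *m (K i *m A *m (K i)^t*) *m X^t*).
pose t2 i := \tr ((K i)^t* *m X *m K i *m (A *m S^t*)).
pose t3 i := \tr (S *m A *m ((K i)^t* *m X^t* *m K i)).
pose t4 i := \tr ((K i)^t* *m K i *m (S *m A *m S^t*)).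
have termE i : \tr ((X *m K i - K i *m S) *m A *m (X *m K i - K i *m S)^t*)
     = t1 i - t3 i - (t2 i - t4 i).
  rewrite adjmxB !adjmxM mulmxBr !mulmxBl !raddfB/=.
  congr (_ - _ + (- _ - - _)).
  - by rewrite /t1 !mulmxA.
  - by rewrite /t3 -!mulmxA [LHS]mxtrace_mulC -!mulmxA.
  - by rewrite /t2 -!mulmxA [RHS]mxtrace_mulC -!mulmxA.
  - by rewrite /t4 -!mulmxA [RHS]mxtrace_mulC -!mulmxA.
rewrite (eq_bigr _ (fun i _ => termE i)) !sumrB/=.
have -> : \sum_i t1 i = \tr (X *m kraus_mx A *m X^t*).
  by rewrite mulmx_sumr mulmx_suml linear_sum.
have -> : \sum_i t2 i = \tr (S *m A *m S^t*).
  by rewrite -mulmxA /S mulmx_suml linear_sum.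
have -> : \sum_i t3 i = \tr (S *m A *m S^t*).
  by rewrite -[S^t*]kraus_dual_adj mulmx_sumr linear_sum.
have -> : \sum_i t4 i = \tr (S *m A *m S^t*).
  by rewrite -[in RHS](mul1mx (S *m A *m S^t*)) -KK mulmx_suml linear_sum.
by rewrite !subrr subr0.
Qed.

(** Duality leaves the linear term unchanged. Both quadratic terms carry a minus sign and shrink by
    Kadison-Schwarz, applied to [X^t*] for [A] and to [X] for [B]. *)
Lemma chi2_form_kraus s A B E F (a b : 'rV[C]_m) X : 0 < s < 1 ->
  (forall k, 0 <= a 0 k) -> (forall k, 0 <= b 0 k) ->
  spectral_mx A E a -> spectral_mx B F b ->
  chi2_form s (kraus_mx A) (kraus_mx B) X <= chi2_form s A B (kraus_dual X).
Proof.
move=> /andP[s0 s1] a0 b0 sA sB; rewrite /chi2_form.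
have -> : kraus_mx A - kraus_mx B = kraus_mx (A - B).
  rewrite -sumrB; apply: eq_bigr => i _; by rewrite mulmxBr mulmxBl.
rewrite mxtrace_kraus kraus_dual_adj; apply: lerB; first apply: lerB => //.
  apply: ler_wpM2l; first exact: ltW.
  by have := kadison_schwarz (X^t*) sA a0; rewrite kraus_dual_adj !trmxCK.
apply: ler_wpM2l; first by rewrite subr_ge0 ltW.
exact: kadison_schwarz sB b0.
Qed.

(** The dual channel turns an optimal [X] for the outputs into a test matrix for the inputs. *)
Lemma chi2_kraus_le s A B E F (a b : 'rV[C]_m) E' F' (a' b' : 'rV[C]_p) : 0 < s < 1 ->
  (forall k, 0 <= a 0 k) -> (forall k, 0 <= b 0 k) ->
  (forall k, 0 <= a' 0 k) -> (forall k, 0 <= b' 0 k) ->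
  spectral_mx A E a -> spectral_mx B F b ->
  spectral_mx (kraus_mx A) E' a' -> spectral_mx (kraus_mx B) F' b' ->
  \sum_k \sum_l overlap E' F' k l * chi2 s (a' 0 k) (b' 0 l) <=
  \sum_k \sum_l overlap E F k l * chi2 s (a 0 k) (b 0 l).
Proof.
move=> s01 a0 b0 a0' b0' sA sB sA' sB'.
have [X <-] := chi2_form_attained s01 a0' b0' sA' sB'.
exact: le_trans (chi2_form_kraus X s01 a0 b0 sA sB) (chi2_form_le _ s01 a0 b0 sA sB).
Qed.

Lemma mxtrace_kraus_id A : \tr (kraus_mx A) = \tr A.
Proof.
rewrite -[kraus_mx A]mul1mx mxtrace_kraus /kraus_dual.
by rewrite (eq_bigr _ (fun i _ => congr1 (mulmx^~ (K i)) (mulmx1 _))) KK mul1mx.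
Qed.

End Channel.

(** The overlaps of two orthonormal bases form a doubly stochastic matrix. *)
Lemma sum_overlap_trace n (A B E F : 'M[C]_n) (a b : 'rV[C]_n) :
  spectral_mx A E a -> spectral_mx B F b ->
  \sum_k \sum_l overlap E F k l * (a 0 k - b 0 l) = \tr A - \tr B.
Proof.
move=> [uE ->] [uF ->]; have /unitarymxP EE := uE; have /unitarymxP FF := uF.
have {}EE' := mulmx1C EE; have {}FF' := mulmx1C FF.
set W := E^t* *m F.
have WE : W^t* = F^t* *m E by rewrite adjmxM trmxCK.
have -> : \tr (E *m diag_mx a *m E^t*) = \tr (W^t* *m diag_mx a *m W).
  by rewrite WE /W !mulmxA [RHS]mxtrace_mulC !mulmxA FF mul1mx.
have -> : \tr (F *m diag_mx b *m F^t*) = \tr (W^t* *m W *m diag_mx b).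
  rewrite [LHS]mxtrace_mulC !mulmxA FF' mul1mx WE /W.
  by rewrite -(mulmxA _ E) EE mulmx1 FF' mul1mx.
rewrite mxtrace_adj_diag mxtrace_mul_diag -sumrB; apply: eq_bigr => k _.
rewrite -sumrB; apply: eq_bigr => l _; rewrite /overlap -/W normCK; ring.
Qed.

Lemma hermitian_spectral_mx n (A : 'M[C]_n) : A^t* = A ->
  exists E a, spectral_mx A E a /\ (forall k, a 0 k \is Num.real).
Proof.
move=> hA.
have hM : A \is hermsymmx by apply/(is_hermitianmxP _ _ _); rewrite expr0 scale1r hA.
exists ((spectralmx A)^t*), (spectral_diag A); split; last first.
  by move=> k; apply: (mxOverP (hermitian_spectral_diag_real hM)).
split; first by rewrite trmxC_unitary spectral_unitarymx.
have /orthomx_spectralP := hermitian_normalmx hM.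
by rewrite invmx_unitary ?spectral_unitarymx// trmxCK.
Qed.

End Matrix.

(** * Monotonicity of the relative entropy *)

Section Relent.
Local Open Scope complex_scope.
Local Open Scope sesquilinear_scope.
Local Open Scope ring_scope.
Context {R : realType}.
Local Notation C := R[i].

Lemma sqnormE (z : C) : (sqnorm z)%:C = `|z| ^+ 2.
Proof. exact: add_Re2_Im2. Qed.

Lemma conjcE (z : C) : conjc z = z^*.
Proof. by []. Qed.

Lemma conj_realC (u : R) : (u%:C)^* = u%:C.
Proof. exact: conjc_real. Qed.

Lemma sum_enum_val (T : finType) (V : nmodType) (F : T -> V) :
  \sum_(i < #|T|) F (enum_val i) = \sum_x F x.
Proof. by rewrite -(big_enum_val (A := T)). Qed.

Lemma sum_rot (T S I : finType) (V : nmodType) (F : T -> S -> I -> V) :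
  \sum_x \sum_y \sum_i F x y i = \sum_i \sum_x \sum_y F x y i.
Proof. by under eq_bigr do rewrite exchange_big; rewrite exchange_big. Qed.

(** Transfers kernels on finite types to matrices, where products, adjoints and the spectral theorem
    are at hand. *)
Definition opmx (T S : finType) (A : T -> S -> C) : 'M[C]_(#|T|, #|S|) :=
  \matrix_(i, j) A (enum_val i) (enum_val j).

Lemma opmxM (T S U : finType) (A : T -> S -> C) (B : S -> U -> C) :
  opmx A *m opmx B = opmx (fun x y => \sum_z A x z * B z y).
Proof.
apply/matrixP => i j; rewrite !mxE.
rewrite -(sum_enum_val (fun z => A (enum_val i) z * B z (enum_val j))).
by apply: eq_bigr => k _; rewrite !mxE.
Qed.

Lemma opmx_adj (T S : finType) (A : T -> S -> C) :
  (opmx A)^t* = opmx (fun x y => (A y x)^*).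
Proof. by apply/matrixP => i j; rewrite !mxE. Qed.

Lemma opmx_id (T : finType) : opmx (fun x y : T => (x == y)%:R) = 1%:M.
Proof. by apply/matrixP => i j; rewrite !mxE (inj_eq enum_val_inj). Qed.

Lemma opmx_sum (T S I : finType) (A : I -> T -> S -> C) :
  \sum_i opmx (A i) = opmx (fun x y => \sum_i A i x y).
Proof.
by apply/matrixP => i j; rewrite summxE !mxE; apply: eq_bigr => k _; rewrite mxE.
Qed.

Lemma spectral_decomp_mx (T : finType) (A : op R T) e lam :
  spectral_decomp A e lam ->
  spectral_mx (opmx A) (opmx (fun x k => e k x)) (\row_i (lam (enum_val i))%:C).
Proof.
move=> [oe Ae]; split.
  apply/unitarymxP; apply: mulmx1C; rewrite opmx_adj opmxM -opmx_id.
  apply/matrixP => i j; rewrite !mxE; exact: oe.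
rewrite opmx_adj; apply/matrixP => i j; rewrite mul_mx_diag !mxE Ae -sum_enum_val.
by apply: eq_bigr => k _; rewrite !mxE [in LHS](mulrC (_%:C)).
Qed.

Lemma overlap_cdot (T : finType) (e f : T -> T -> C) i j :
  overlap (opmx (fun x k => e k x)) (opmx (fun x k => f k x)) i j =
  (sqnorm (cdot (e (enum_val i)) (f (enum_val j))))%:C.
Proof. by rewrite sqnormE /overlap opmx_adj opmxM mxE. Qed.

Lemma hermitian_spectral (T : finType) (A : op R T) :
  Defs.hermitian A -> exists e lam, spectral_decomp A e lam.
Proof.
move=> hA; have [|E [a [[uE AE] aR]]] := @hermitian_spectral_mx _ _ (opmx A).
  by apply/matrixP => i j; rewrite !mxE [RHS]hA.
exists (fun k x => E (enum_rank x) (enum_rank k)), (fun k => complex.Re (a 0 (enum_rank k))).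
split.
  have /unitarymxP/mulmx1C/matrixP EE := uE.
  move=> k l; have := EE (enum_rank k) (enum_rank l).
  rewrite !mxE (inj_eq enum_rank_inj) => <-; rewrite /cdot -sum_enum_val.
  by apply: eq_bigr => i _; rewrite !mxE enum_valK.
move=> x y; have /matrixP/(_ (enum_rank x) (enum_rank y)) := AE.
rewrite mxE !enum_rankK => ->; rewrite mul_mx_diag mxE -[RHS]sum_enum_val.
by apply: eq_bigr => i _; rewrite !mxE enum_valK RRe_real// [in LHS](mulrC (E _ _)).
Qed.

(** The spectral theorem makes the epsilon choice in [spec] meaningful. *)
Lemma specP (T : finType) (A : op R T) :
  Defs.hermitian A -> spectral_decomp A (spec A).1 (spec A).2.
Proof.
move=> /hermitian_spectral[e [lam h]]; rewrite /spec; set i := inhabits _.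
exact: (epsilon_spec i _ (ex_intro (fun p => spectral_decomp A p.1 p.2) (e, lam) h)).
Qed.

Lemma psd_eigen_ge0 (T : finType) (A : op R T) e lam k :
  psd A -> spectral_decomp A e lam -> 0 <= lam k.
Proof.
move=> [_ pA] [oe Ae]; have := pA (e k).
suff -> : \sum_x \sum_y (e k x)^* * A x y * e k y = (lam k)%:C by rewrite ler0c.
have -> : \sum_x \sum_y (e k x)^* * A x y * e k y =
    \sum_l (lam l)%:C * cdot (e k) (e l) * cdot (e l) (e k).
  transitivity (\sum_x \sum_y \sum_l (lam l)%:C * ((e k x)^* * e l x) * ((e l y)^* * e k y)).
    apply: eq_bigr => x _; apply: eq_bigr => y _; rewrite Ae mulr_sumr mulr_suml.
    by apply: eq_bigr => l _; ring.
  rewrite sum_rot; apply: eq_bigr => l _.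
  rewrite /cdot -mulrA mulr_suml mulr_sumr; apply: eq_bigr => x _.
  by rewrite !mulr_sumr; apply: eq_bigr => y _; ring.
rewrite (bigD1 k)//= big1 => [|l lk]; first by rewrite !oe eqxx !mulr1 addr0.
by rewrite !oe (negPf lk) mulr0.
Qed.

(** * Data processing for channels given by kernels *)

Section Kraus.
Variables (T S I : finType) (K : I -> S -> T -> C).

Definition kraus (A : op R T) : op R S := fun x y =>
  \sum_i \sum_z \sum_z' K i x z * A z z' * (K i y z')^*.

Lemma opmx_kraus A : opmx (kraus A) = kraus_mx (fun i => opmx (K i)) (opmx A).
Proof.
rewrite /kraus_mx -opmx_sum; apply: eq_bigr => i _.
rewrite opmx_adj !opmxM; apply/matrixP => k l; rewrite !mxE exchange_big/=.
by apply: eq_bigr => z _; rewrite mulr_suml.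
Qed.

Lemma kraus_psd A : psd A -> psd (kraus A).
Proof.
move=> [hA pA]; split=> [x y|v].
  rewrite /kraus conjcE rmorph_sum; apply: eq_bigr => i _; rewrite rmorph_sum exchange_big.
  apply: eq_bigr => z _; rewrite rmorph_sum; apply: eq_bigr => z' _.
  by rewrite !rmorphM/= conjCK (hA z' z) conjcE; ring.
have -> : \sum_x \sum_y (v x)^* * kraus A x y * v y =
    \sum_i \sum_z \sum_z' (\sum_x (K i x z)^* * v x)^* * A z z' * (\sum_x (K i x z')^* * v x).
  transitivity (\sum_x \sum_y \sum_i \sum_z \sum_z'
      (v x)^* * K i x z * A z z' * ((K i y z')^* * v y)).
    apply: eq_bigr => x _; apply: eq_bigr => y _; rewrite /kraus mulr_sumr mulr_suml.
    apply: eq_bigr => i _; rewrite mulr_sumr mulr_suml; apply: eq_bigr => z _.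
    by rewrite mulr_sumr mulr_suml; apply: eq_bigr => z' _; ring.
  rewrite sum_rot; apply: eq_bigr => i _; rewrite sum_rot; apply: eq_bigr => z _.
  rewrite sum_rot; apply: eq_bigr => z' _.
  rewrite rmorph_sum !mulr_suml; apply: eq_bigr => x _.
  rewrite mulr_sumr; apply: eq_bigr => y _.
  by rewrite rmorphM/= conjCK; ring.
by apply: sumr_ge0 => i _; exact: pA.
Qed.

Hypothesis KK : forall z z', \sum_i \sum_x (K i x z)^* * K i x z' = (z == z')%:R.

(** The argument applies to whichever decompositions [spec] selects: it uses only that they are
    spectral with nonnegative eigenvalues. The family compared is indexed by pairs of eigenvectors,
    weighted by their overlaps. *)
Theorem relent_kraus_le A B : psd A -> psd B ->
  (relent (kraus A) (kraus B) <= relent A B)%E.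
Proof.
move=> pA pB; have pKA := kraus_psd pA; have pKB := kraus_psd pB.
rewrite /relent.
have := specP pA.1; have := specP pB.1; have := specP pKA.1; have := specP pKB.1.
case: (spec (kraus B)) => f' b'; case: (spec (kraus A)) => e' a'.
case: (spec B) => f b; case: (spec A) => e a /= sKB sKA sB sA.
have a0 k := psd_eigen_ge0 k pA sA; have b0 k := psd_eigen_ge0 k pB sB.
have a0' k := psd_eigen_ge0 k pKA sKA; have b0' k := psd_eigen_ge0 k pKB sKB.
have KKm : \sum_i (opmx (K i))^t* *m opmx (K i) = 1%:M.
  rewrite -opmx_id; under eq_bigr do rewrite opmx_adj opmxM.
  by rewrite opmx_sum; apply/matrixP => i j; rewrite !mxE KK.
have mA := spectral_decomp_mx sA; have mB := spectral_decomp_mx sB.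
have mKA := spectral_decomp_mx sKA; have mKB := spectral_decomp_mx sKB.
(* Passes from sums over matrix indices in [C] to real sums over pairs; used once for [chi2] and
   once for the difference of eigenvalues. *)
have sumE (U : finType) (e1 f1 : U -> U -> C) (a1 b1 : U -> R) (g : C -> C -> C) (h : R -> R -> R) :
    (forall x y, g x%:C y%:C = (h x y)%:C) ->
    \sum_k \sum_l overlap (opmx (fun x k => e1 k x)) (opmx (fun x k => f1 k x)) k l *
      g ((\row_i (a1 (enum_val i))%:C) 0 k) ((\row_i (b1 (enum_val i))%:C) 0 l) =
    (\sum_(p : U * U) sqnorm (cdot (e1 p.1) (f1 p.2)) * h (a1 p.1) (b1 p.2))%:C.
  move=> gh; rewrite -(pair_bigA _ (fun k l => sqnorm (cdot (e1 k) (f1 l)) * h (a1 k) (b1 l)))/=.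
  rewrite rmorph_sum -[RHS]sum_enum_val; apply: eq_bigr => k _.
  rewrite rmorph_sum -[RHS]sum_enum_val; apply: eq_bigr => l _.
  by rewrite overlap_cdot !mxE gh -rmorphM.
rewrite !pair_bigA/=.
apply: sum_relent_term_le => //.
- by move=> p; rewrite addr_ge0// sqr_ge0.
- by move=> p; rewrite addr_ge0// sqr_ge0.
- move=> s /andP[s0 s1].
  have chiE x y : chi2 s%:C x%:C y%:C = (chi2 s x y)%:C.
    by rewrite /chi2 /mix [RHS]fmorph_div rmorphXn rmorphB rmorphD !rmorphM rmorphB rmorph1.
  rewrite -lecR -!(sumE _ _ _ _ _ _ _ chiE).
  move: mKA mKB; rewrite !opmx_kraus => mKA mKB.
  apply: (chi2_kraus_le KKm _ _ _ _ _ mA mB mKA mKB); try by move=> k; rewrite mxE ler0c.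
  by rewrite -[X in _ < _ < X]/(1%:C) !ltcR s0.
- apply: complexI; have subE (x y : R) : x%:C - y%:C = (x - y)%:C by rewrite rmorphB.
  rewrite -!(sumE _ _ _ _ _ (fun x y => x - y) _ subE).
  rewrite (sum_overlap_trace mA mB) (sum_overlap_trace mKA mKB) !opmx_kraus.
  by rewrite !(mxtrace_kraus_id KKm).
Qed.

End Kraus.
End Relent.

(** * Dephasing maps in the computational basis *)

Section Characters.
Local Open Scope complex_scope.
Local Open Scope ring_scope.
Context {R : realType} (d : nat).
Hypothesis d1 : (1 < d)%N.
Local Notation C := R[i].

Let theta (m : nat) : R := 2 * pi * m%:R / d%:R.
(** The character on natural exponents, where addition involves no reduction modulo [d]; [root_modn]
    brings it back to ['Z_d]. *)
Let root (m : nat) : C := cos (theta m) +i* sin (theta m).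

Let d0 : d%:R != 0 :> R.
Proof. by rewrite pnatr_eq0 -lt0n ltnW. Qed.

Let chiE (a : 'Z_d) : chi R a = root (val a).
Proof. by rewrite /root [RHS]complexE. Qed.

Let rootD m p : root (m + p) = root m * root p.
Proof.
have tD : theta (m + p) = theta m + theta p by rewrite /theta natrD; field.
apply/eqP; rewrite eq_complex /root tD cosD sinD /=.
by apply/andP; split; apply/eqP; ring.
Qed.

Let root0 : root 0 = 1.
Proof. by rewrite /root /theta mulr0 mul0r cos0 sin0. Qed.

Let root_modn m : root (m %% d) = root m.
Proof.
have rootd : root d = 1.
  have -> : root d = cos (pi *+ 2) +i* sin (pi *+ 2).
    by rewrite /root /theta (_ : 2 * pi * d%:R / d%:R = pi *+ 2)//; field.
  by rewrite cos2pi sin2pi.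
rewrite {2}(divn_eq m d) rootD.
elim: (m %/ d)%N => [|k IH]; first by rewrite mul0n root0 mul1r.
by rewrite mulSn rootD rootd mul1r.
Qed.

Lemma chiD (a b : 'Z_d) : chi R (a + b) = chi R a * chi R b.
Proof.
rewrite !chiE -rootD -[RHS]root_modn; congr root.
(* Addition in ['Z_d] reduces modulo [(Zp_trunc d).+2], which is [d] because [1 < d]. *)
by transitivity ((val a + val b) %% (Zp_trunc d).+2)%N; last by congr modn; exact: Zp_cast.
Qed.

Lemma chi0 : chi R (0 : 'Z_d) = 1.
Proof. by rewrite chiE root0. Qed.

Lemma conj_chi (a : 'Z_d) : (chi R a)^* = chi R (- a).
Proof.
have aN : chi R a * chi R (- a) = 1 by rewrite -chiD subrr chi0.
have aC : chi R a * (chi R a)^* = 1.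
  rewrite chiE; apply/eqP; rewrite eq_complex /=; apply/andP; split; apply/eqP.
    by rewrite mulrN opprK -!expr2 cos2Dsin2.
  by ring.
have a0 : chi R a != 0.
  by apply/eqP => a0; move: aN; rewrite a0 mul0r => /eqP; rewrite eq_sym oner_eq0.
by apply: (mulfI a0); rewrite aN aC.
Qed.

Lemma chi_neq1 (a : 'Z_d) : a != 0 -> chi R a != 1.
Proof.
move=> a0; rewrite chiE; apply/negP; rewrite eq_complex /= => /andP[/eqP c1 _].
(* Half the angle of [chi R a]. It lies strictly between [0] and [pi], so [sin t > 0], whereas
   [cos (t + t) = 1] forces [sin t = 0]. *)
pose t : R := pi * (val a)%:R / d%:R.
have tE : theta (val a) = t + t by rewrite /theta /t; field.
have dgt0 : 0 < d%:R :> R by rewrite ltr0n ltnW.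
have a_gt0 : 0 < (val a)%:R :> R.
  by rewrite ltr0n lt0n; apply: contra a0 => /eqP e; apply/eqP/val_inj.
have a_lt : (val a)%:R < d%:R :> R by rewrite ltr_nat (leq_trans (ltn_ord a))// (Zp_cast d1).
have : 0 < sin t.
  apply: sin_gt0_pi; rewrite /t divr_gt0 ?mulr_gt0 ?pi_gt0//=.
  by rewrite ltr_pdivrMr// ltr_pM2l// pi_gt0.
move: c1; rewrite tE cosD; have := cos2Dsin2 t; rewrite !expr2; nra.
Qed.

Lemma sum_chi (m : 'Z_d) : \sum_(j : 'Z_d) chi R (j * m) = (m == 0)%:R * d%:R.
Proof.
have [->|m0] := eqVneq m 0.
  rewrite (eq_bigr (fun => 1)) => [|j _]; last by rewrite mulr0 chi0.
  by rewrite sumr_const card_ord (Zp_cast d1) mul1r.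
rewrite mul0r; set S := \sum_j _.
(* Multiplying [S] by [chi R m] only shifts the summation index by [1]. *)
have : S * (chi R m - 1) = 0.
  rewrite mulrBr mulr1 {2}/S (reindex_inj (addIr 1))/= mulr_suml -sumrB big1// => j _.
  by rewrite (_ : (j + 1) * m = j * m + m) ?chiD ?subrr//; ring.
by move/eqP; rewrite mulf_eq0 subr_eq0 (negPf (chi_neq1 m0)) orbF => /eqP.
Qed.

End Characters.

Section Dephase.
Local Open Scope complex_scope.
Local Open Scope ring_scope.
Context {R : realType} (d n : nat).
Hypothesis d1 : (1 < d)%N.
Local Notation C := R[i].
Local Notation qudit := (qudit d n).
Implicit Types (x y : qudit) (rho : op R qudit).

Definition upd (k : 'I_n) x (c : 'Z_d) : qudit := [ffun m => if m == k then c else x m].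

Definition shift (k : 'I_n) (c : 'Z_d) x : qudit := upd k x (x k + c).

Lemma sum_agree k x (F : qudit -> C) :
  \sum_(u : qudit) ([forall m : 'I_n, (m != k) ==> (x m == u m)])%:R * F u = \sum_c F (upd k x c).
Proof.
rewrite (eq_bigr
  (fun u : qudit => if [forall m : 'I_n, (m != k) ==> (x m == u m)] then F u else 0)).
  rewrite -big_mkcond (reindex_onto (upd k x) (fun u : qudit => u k))/=.
    apply: eq_bigl => c; rewrite ffunE eqxx eqxx andbT.
    by apply/forallP => m; apply/implyP => mk; rewrite ffunE (negPf mk).
  move=> u /forallP xu; apply/ffunP => m; rewrite ffunE.
  by case: eqVneq => [->//|mk]; apply/eqP; have := xu m; rewrite mk.
by move=> u _; case: ifP; rewrite ?mul1r ?mul0r.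
Qed.

(** Isolates the one-qudit kernel in parentheses, so that each Pauli basis requires only the
    evaluation of a sum over [j]. *)
Lemma dephaseE P k rho x y : dephase P k rho x y =
  \sum_c \sum_c' (\sum_j eigket R P j (x k) * (eigket R P j c)^* *
     eigket R P j c' * (eigket R P j (y k))^*) * rho (upd k x c) (upd k y c').
Proof.
have sym (u v : qudit) : [forall m : 'I_n, (m != k) ==> (u m == v m)]
   = [forall m : 'I_n, (m != k) ==> (v m == u m)].
  by apply: eq_forallb => m; rewrite (eq_sym (u m)).
have updE u c : upd k u c k = c by rewrite ffunE eqxx.
rewrite (eq_bigr (fun c => \sum_c' \sum_j eigket R P j (x k) * (eigket R P j c)^* *
    eigket R P j c' * (eigket R P j (y k))^* * rho (upd k x c) (upd k y c'))); last first.
  by move=> c _; apply: eq_bigr => c' _; rewrite mulr_suml.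
rewrite sum_rot; apply: eq_bigr => j _; rewrite exchange_big /mulop.
set e := eigket R P j.
have inner (v : qudit) : \sum_(u : qudit) Hproj R P k j x u * rho u v =
    \sum_c e (x k) * (e c)^* * rho (upd k x c) v.
  transitivity (\sum_(u : qudit) ([forall m : 'I_n, (m != k) ==> (x m == u m)])%:R *
      (e (x k) * (e (u k))^* * rho u v)).
    by apply: eq_bigr => u _; rewrite /Hproj -/e !mulrA.
  by rewrite sum_agree; apply: eq_bigr => c _; rewrite updE.
transitivity (\sum_(v : qudit) ([forall m : 'I_n, (m != k) ==> (y m == v m)])%:R *
    (\sum_c e (x k) * (e c)^* * rho (upd k x c) v * (e (v k) * (e (y k))^*))).
  apply: eq_bigr => v _; rewrite inner /Hproj -/e sym -[in RHS]mulr_suml.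
  by rewrite -[in LHS](mulrA _ (e _)) mulrCA.
rewrite sum_agree; apply: eq_bigr => c' _; apply: eq_bigr => c _.
by rewrite updE -/e; ring.
Qed.

Lemma dephaseZE k rho x y : dephase PZ k rho x y = (x k == y k)%:R * rho x y.
Proof.
have updk u : upd k u (u k) = u.
  by apply/ffunP => m; rewrite ffunE; case: eqVneq => [->|].
have kappa c c' : \sum_j eigket R PZ j (x k) * (eigket R PZ j c)^* *
     eigket R PZ j c' * (eigket R PZ j (y k))^* =
     (c == x k)%:R * ((c' == y k)%:R * (x k == y k)%:R).
  rewrite (bigD1 (x k))//= big1 => [|j jx].
    rewrite addr0 eqxx mul1r !rmorph_nat (eq_sym (y k)).
    by have [->|_] := eqVneq (x k) (y k); rewrite !(mulr1, mulr0).
  by rewrite eq_sym (negPf jx) !mul0r.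
rewrite dephaseE; under eq_bigr do under eq_bigr do rewrite kappa.
rewrite (bigD1 (x k))//= [X in _ + X]big1 ?addr0 => [|c /negPf cx]; last first.
  by rewrite big1// => c' _; rewrite cx !mul0r.
rewrite (bigD1 (y k))//= [X in _ + X]big1 ?addr0 => [|c /negPf cx]; last first.
  by rewrite cx mul0r mulr0 mul0r.
by rewrite !eqxx !mul1r !updk.
Qed.

(** Orthogonality of characters collapses the one-qudit kernel to the constraint that both indices
    move by the same amount, which leaves an average over shifts. *)
Lemma dephaseXE k rho x y : dephase PX k rho x y =
  d%:R^-1 * \sum_c rho (shift k c x) (shift k c y).
Proof.
have d0 : (d%:R : C) != 0 by rewrite pnatr_eq0 -lt0n ltnW.
pose r : C := ((Num.sqrt (d%:R : R))^-1)%:C.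
have rr : r * r^* = d%:R^-1.
  rewrite /r -conjcE conjc_real -rmorphM/= -expr2 exprVn sqr_sqrtr ?ler0n//.
  by rewrite fmorphV rmorph_nat.
have kappa c c' : \sum_j eigket R PX j (x k) * (eigket R PX j c)^* *
     eigket R PX j c' * (eigket R PX j (y k))^* =
     d%:R^-1 * (c' == y k + (c - x k))%:R.
  transitivity (d%:R^-1 * d%:R^-1 * \sum_j chi R (j * (y k + (c - x k) - c'))).
    rewrite mulr_sumr; apply: eq_bigr => j _ /=; rewrite -/r -rr.
    rewrite !rmorphM/= !conj_chi// !opprK.
    rewrite (_ : j * _ = - (j * x k) + j * c + - (j * c') + j * y k); last by ring.
    by rewrite !chiD//; ring.
  rewrite sum_chi// subr_eq0 (eq_sym c'); set b := (_ == _).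
  by clear -d0; move: d0; move: (b%:R : C) (d%:R : C) => u v v0; field.
rewrite dephaseE mulr_sumr (reindex_inj (addrI (x k)))/=.
apply: eq_bigr => c _; under eq_bigr do rewrite kappa.
rewrite (bigD1 (y k + c))//= big1 ?addr0 => [|c' /negPf cx].
  by rewrite addrAC subrr add0r eqxx mulr1.
by rewrite addrAC subrr add0r cx mulr0 mul0r.
Qed.

End Dephase.

(** * The convolution *)

Lemma sum_delta (T : finType) (V : pzRingType) (c : T) (F : T -> V) :
  \sum_z (z == c)%:R * F z = F c.
Proof.
rewrite (bigD1 c)//= big1 ?addr0 ?eqxx ?mul1r// => z /negPf zc.
by rewrite zc mul0r.
Qed.

(** * Convolution by a permutation of the product basis *)

Section PermConv.
Local Open Scope complex_scope.
Local Open Scope ring_scope.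
Context {R : realType} (T : finType).
Local Notation C := R[i].
Variables phi psi : T * T -> T * T.
Hypotheses (phiK : cancel phi psi) (psiK : cancel psi phi).

(** The partial trace of the conjugate of [rho] tensor [sigma] by the permutation unitary sending
    the basis vector [v] to [psi v]; its entries are read through the inverse [phi]. *)
Definition permconv (rho sigma : op R T) : op R T := fun x y =>
  \sum_b rho (phi (x, b)).1 (phi (y, b)).1 * sigma (phi (x, b)).2 (phi (y, b)).2.

(** For [i = (k, b)], the operator applies the permutation unitary to [sqrt a_k e_k] tensor the
    input and projects the second register onto [b]. *)
Definition permconv_kraus (e : T -> T -> C) (a : T -> R) (i : T * T) (x z : T) : C :=
  (z == (phi (x, i.2)).2)%:R * ((Num.sqrt (a i.1))%:C * e i.1 (phi (x, i.2)).1).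

Lemma permconvE rho e a sigma : spectral_decomp rho e a -> (forall k, 0 <= a k) ->
  permconv rho sigma = kraus (permconv_kraus e a) sigma.
Proof.
move=> [_ rhoE] a0; apply/funext => x; apply/funext => y.
rewrite /kraus -(pair_bigA _ (fun k b => \sum_z \sum_z' permconv_kraus e a (k, b) x z *
  sigma z z' * (permconv_kraus e a (k, b) y z')^*))/= exchange_big.
apply: eq_bigr => b _; rewrite rhoE mulr_suml; apply: eq_bigr => k _.
transitivity (\sum_z (z == (phi (x, b)).2)%:R * \sum_z' (z' == (phi (y, b)).2)%:R *
    ((a k)%:C * e k (phi (x, b)).1 * (e k (phi (y, b)).1)^* * sigma z z')).
  by rewrite !sum_delta.
apply: eq_bigr => z _; rewrite mulr_sumr; apply: eq_bigr => z' _.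
rewrite /permconv_kraus !rmorphM/= rmorph_nat conj_realC.
rewrite -{1}(sqr_sqrtr (a0 k)) rmorphXn/=; ring.
Qed.

(** Since [phi] is a bijection, the sum over [(x, b)] runs over all input pairs [(u, w)]: the deltas
    fix [w], and the sum over [u] is the trace of [rho]. *)
Lemma permconv_krausK rho e a : spectral_decomp rho e a -> (forall k, 0 <= a k) ->
  trace rho = 1 -> forall z z',
  \sum_i \sum_x (permconv_kraus e a i x z)^* * permconv_kraus e a i x z' = (z == z')%:R.
Proof.
move=> [_ rhoE] a0 tr1 z z'.
rewrite -(pair_bigA _ (fun k b => \sum_x (permconv_kraus e a (k, b) x z)^* *
  permconv_kraus e a (k, b) x z'))/=.
transitivity (\sum_x \sum_b (z == (phi (x, b)).2)%:R * ((z' == (phi (x, b)).2)%:R *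
    rho (phi (x, b)).1 (phi (x, b)).1)).
  under [RHS]eq_bigr do under eq_bigr do rewrite rhoE !mulr_sumr.
  rewrite [RHS]sum_rot; apply: eq_bigr => k _; rewrite exchange_big.
  apply: eq_bigr => x _; apply: eq_bigr => b _.
  rewrite /permconv_kraus !rmorphM/= rmorph_nat conj_realC.
  by rewrite -[in RHS](sqr_sqrtr (a0 k)) rmorphXn/=; ring.
rewrite (pair_bigA _ (fun x b => (z == (phi (x, b)).2)%:R * ((z' == (phi (x, b)).2)%:R *
    rho (phi (x, b)).1 (phi (x, b)).1)))/=.
rewrite (reindex psi)/=; last by exists phi => p _.
under eq_bigr do rewrite -surjective_pairing psiK.
rewrite -(pair_bigA _ (fun u w => (z == w)%:R * ((z' == w)%:R * rho u u)))/=.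
under eq_bigr do under eq_bigr do rewrite (eq_sym z).
under eq_bigr do rewrite sum_delta.
by rewrite -mulr_sumr -/(trace rho) tr1 mulr1 eq_sym.
Qed.

Theorem relent_permconv_le rho A B : is_state rho -> psd A -> psd B ->
  (relent (permconv rho A) (permconv rho B) <= relent A B)%E.
Proof.
move=> [prho tr1] pA pB; have srho := specP prho.1.
have a0 k := psd_eigen_ge0 k prho srho.
rewrite !(permconvE _ srho a0); apply: relent_kraus_le => //.
exact: permconv_krausK srho a0 tr1.
Qed.

End PermConv.

Lemma permconv_swap (R : realType) (T : finType) phi (rho sigma : op R T) :
  permconv (fun p => ((phi p).2, (phi p).1)) sigma rho = permconv phi rho sigma.
Proof.
apply/funext => x; apply/funext => y; apply: eq_bigr => b _.
by rewrite mulrC.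
Qed.

Lemma Zp_unit d (a : 'Z_d) : prime d -> a != 0 -> a \is a GRing.unit.
Proof.
move=> pd a0; have d1 := prime_gt1 pd.
rewrite -[a]natr_Zp unitZpE// prime_coprime// gtnNdvd//.
  by rewrite lt0n; apply: contra a0 => /eqP e; apply/eqP/val_inj.
by rewrite (leq_trans (ltn_ord a))// (Zp_cast d1).
Qed.

(** * The key unitary as a linear change of variables *)

Section KeyMap.
Variables d n : nat.
Implicit Types G : 'M['Z_d]_2.

Definition lincomb (a b : 'Z_d) (x y : qudit d n) : qudit d n := [ffun m => a * x m + b * y m].

(** Right multiplication of the row vector [(v.1, v.2)] by [G], coordinate by coordinate; it inverts
    [keymap]. *)
Definition keymapV G (v : qudit d n * qudit d n) : qudit d n * qudit d n :=
  (lincomb (g00 G) (g10 G) v.1 v.2, lincomb (g01 G) (g11 G) v.1 v.2).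

Lemma det_key G : \det G = g00 G * g11 G - g01 G * g10 G.
Proof.
have lift0 : lift ord0 ord0 = ord_max :> 'I_2 by apply/val_inj.
have lift1 : lift ord_max ord0 = ord0 :> 'I_2 by apply/val_inj.
rewrite (expand_det_row _ ord0) !big_ord_recl big_ord0 /cofactor !det_mx11 !mxE.
rewrite lift0 lift1 /= /g00 /g01 /g10 /g11.
rewrite /=; ring.
Qed.

Lemma keymapVK G : \det G \is a GRing.unit -> cancel (keymapV G) (keymap G).
Proof.
move=> /mulVr; rewrite -/(Ninv G) det_key => N [x y].
rewrite /keymap /keymapV /=; congr pair; apply/ffunP => m; rewrite !ffunE.
  by rewrite -[RHS]mul1r -N; ring.
by rewrite -[RHS]mul1r -N; ring.
Qed.

Lemma keymapK G : \det G \is a GRing.unit -> cancel (keymap G) (keymapV G).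
Proof.
move=> /mulVr; rewrite -/(Ninv G) det_key => N [x y].
rewrite /keymap /keymapV /=; congr pair; apply/ffunP => m; rewrite !ffunE.
  by rewrite -[RHS]mul1r -N; ring.
by rewrite -[RHS]mul1r -N; ring.
Qed.

Lemma boxconvE (R : realType) G (rho sigma : op R (qudit d n)) : \det G \is a GRing.unit ->
  boxconv G rho sigma = permconv (keymapV G) rho sigma.
Proof.
move=> uG; apply/funext => x; apply/funext => y; apply: eq_bigr => b _.
have UE u v : keyU R G u v = (v == keymapV G u)%:R.
  rewrite /keyU; congr (nat_of_bool _)%:R.
  by apply/eqP/eqP => ->; rewrite ?keymapK ?keymapVK.
rewrite /mulop /adj.
transitivity (\sum_z (z == keymapV G (y, b))%:R *
    \sum_z' (z' == keymapV G (x, b))%:R * tensor rho sigma z' z).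
  apply: eq_bigr => z _; rewrite UE conjcE rmorph_nat mulrC; congr (_ * _).
  by apply: eq_bigr => z' _; rewrite UE.
by rewrite !sum_delta.
Qed.

End KeyMap.

(** * Commutation with dephasing and monotonicity of [Jfun] *)

Section Fisher.
Local Open Scope complex_scope.
Local Open Scope ring_scope.
Context {R : realType} (d n : nat).
Hypothesis dP : prime d.
Local Notation C := R[i].
Local Notation qudit := (qudit d n).
Implicit Types (G : 'M['Z_d]_2) (rho sigma : op R qudit).

Let d1 : (1 < d)%N := prime_gt1 dP.

Lemma dephase_psd P k sigma : psd sigma -> psd (dephase P k sigma).
Proof.
move=> psig.
have -> : dephase P k sigma = kraus (fun j => Hproj R P k j) sigma; last exact: kraus_psd.
apply/funext => x; apply/funext => y; apply: eq_bigr => j _.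
rewrite /mulop exchange_big; apply: eq_bigr => z _; rewrite mulr_suml.
apply: eq_bigr => z' _; congr (_ * _); rewrite /Hproj !rmorphM/= rmorph_nat conjCK.
rewrite -!mulrA [in RHS](mulrC (_^*)); congr ((nat_of_bool _)%:R * _).
by apply: eq_forallb => m; rewrite (eq_sym (y m)).
Qed.

(** Row and column share the traced-out [b], so the [k]-th coordinates read by [sigma] agree exactly
    when [g01 * x k = g01 * y k], and [g01] is invertible. *)
Lemma dephaseZ_boxconv G k rho sigma : \det G != 0 -> g01 G != 0 ->
  dephase PZ k (boxconv G rho sigma) = boxconv G rho (dephase PZ k sigma).
Proof.
move=> /(Zp_unit dP) uG /(Zp_unit dP) u01; rewrite !boxconvE//.
apply/funext => x; apply/funext => y; rewrite dephaseZE// mulr_sumr.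
apply: eq_bigr => b _; rewrite dephaseZE// mulrCA; congr (_ * ((nat_of_bool _)%:R * _)).
by rewrite /= !ffunE (inj_eq (addIr _)) (inj_eq (mulrI u01)).
Qed.

Lemma lincomb_shift (a b c c' : 'Z_d) k (x y : qudit) :
  lincomb a b (shift k c x) (shift k c' y) = shift k (a * c + b * c') (lincomb a b x y).
Proof.
by apply/ffunP => m; rewrite !ffunE; case: eqVneq => // _; ring.
Qed.

Lemma shift_inj k c : injective (shift k c : qudit -> qudit).
Proof.
move=> x y /ffunP xy; apply/ffunP => m; have := xy m; rewrite !ffunE.
by case: eqVneq => [->/addIr|].
Qed.

Lemma shift0 k (x : qudit) : shift k 0 x = x.
Proof. by apply/ffunP => m; rewrite ffunE; case: eqVneq => // ->; rewrite addr0. Qed.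

(* A shift by [c] of the output is matched by a shift by [- g10^-1 g00 c] of the traced-out
   register: the first input is then unmoved, and the second is shifted by [- g10^-1 (det G) c]. *)
Lemma dephaseX_boxconv G k rho sigma : \det G != 0 -> g10 G != 0 ->
  dephase PX k (boxconv G rho sigma) = boxconv G rho (dephase PX k sigma).
Proof.
move=> /(Zp_unit dP) uG /(Zp_unit dP) u10; rewrite !boxconvE//.
have gV : g10 G * (g10 G)^-1 = 1 by rewrite mulrV.
have uc : - ((g10 G)^-1 * \det G) \is a GRing.unit by rewrite unitrN unitrM unitrV u10.
apply/funext => x; apply/funext => y; rewrite dephaseXE//.
rewrite /permconv; under [RHS]eq_bigr do rewrite dephaseXE// mulrCA mulr_sumr.
rewrite -mulr_sumr; congr (_ * _); rewrite [RHS]exchange_big/=.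
rewrite [RHS](reindex_inj (mulrI uc)); apply: eq_bigr => c _ /=.
rewrite (reindex_inj (@shift_inj k (- ((g10 G)^-1 * g00 G * c))))/=.
apply: eq_bigr => b _; rewrite /keymapV/= !lincomb_shift.
have -> : g00 G * c + g10 G * - ((g10 G)^-1 * g00 G * c) = 0.
  by rewrite mulrN !mulrA gV mul1r subrr.
have -> : g01 G * c + g11 G * - ((g10 G)^-1 * g00 G * c) = - ((g10 G)^-1 * \det G) * c.
  by rewrite det_key -[X in X * c + _]mulr1 -gV; ring.
by rewrite !shift0.
Qed.

(** Once the dephasing has moved to the second input, each of the four relative entropies compares
    two outputs of the same channel, and [mono] handles both orders of the arguments. *)
Lemma Jfun_boxconv_le G rho sigma : \det G != 0 -> g01 G != 0 -> g10 G != 0 ->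
  is_state rho -> is_state sigma -> (Jfun (boxconv G rho sigma) <= Jfun sigma)%E.
Proof.
move=> detG h01 h10 srho ssig; have uG := Zp_unit dP detG.
have mono A B : psd A -> psd B ->
    (relent (boxconv G rho A) (boxconv G rho B) <= relent A B)%E.
  move=> pA pB; rewrite !boxconvE//.
  exact: (relent_permconv_le (keymapVK uG) (keymapK uG)).
rewrite /Jfun lee_pmul2l// ?lte_fin ?ltr0n//; apply: lee_sum => k _.
rewrite dephaseX_boxconv// dephaseZ_boxconv//.
have psig := ssig.1; have pD P := dephase_psd P k psig.
by apply: leeD; apply: leeD; exact: mono.
Qed.

End Fisher.

Lemma det_xcol2 d (G : 'M['Z_d]_2) : \det (xcol ord0 ord_max G) = - \det G.
Proof. by rewrite !det_key /g00 /g01 /g10 /g11 !mxE !tpermL !tpermR; ring. Qed.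

Lemma boxconv_swap (R : realType) d n G (rho sigma : op R (qudit d n)) :
  \det G \is a GRing.unit ->
  boxconv (xcol ord0 ord_max G) sigma rho = boxconv G rho sigma.
Proof.
move=> uG; rewrite !boxconvE ?det_xcol2 ?unitrN//.
have -> : keymapV (xcol ord0 ord_max G) =
    fun p : qudit d n * qudit d n => ((keymapV G p).2, (keymapV G p).1).
  by apply/funext => p; rewrite /keymapV /g00 /g01 /g10 /g11 !mxE !tpermL !tpermR.
exact: permconv_swap.
Qed.

Unset Implicit Arguments.

Theorem mainTheorem13 (R : realType) (d n : nat) (G : 'M['Z_d]_2)
    (rhoA rhoB : op R (qudit d n)) :
  prime d -> (0 < n)%N -> \det G != 0 ->
  is_state rhoA -> is_state rhoB ->
  [/\ (odd_parity_positive G ->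
         (Jfun (boxconv G rhoA rhoB) <= Jfun rhoB)%E),
      (even_parity_positive G ->
         (Jfun (boxconv G rhoA rhoB) <= Jfun rhoA)%E) &
      (positiveG G ->
         (Jfun (boxconv G rhoA rhoB) <= mine (Jfun rhoA) (Jfun rhoB))%E)].
Proof.
move=> dP _ detG sA sB.
have odd : odd_parity_positive G -> (Jfun (boxconv G rhoA rhoB) <= Jfun rhoB)%E.
  by case/and3P => _ h01 h10; exact: Jfun_boxconv_le.
have even : even_parity_positive G -> (Jfun (boxconv G rhoA rhoB) <= Jfun rhoA)%E.
  (* Exchanging the columns puts [g00] and [g11] in the places of [g01] and [g10], and [rhoA]
     becomes the second input. *)
  case/and3P => _ h00 h11; rewrite -boxconv_swap ?(Zp_unit dP)//.
  apply: Jfun_boxconv_le => //.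
  - by rewrite det_xcol2 oppr_eq0.
  - by rewrite /g01 mxE tpermR.
  - by rewrite /g10 mxE tpermL.
split=> // /andP[/odd hB /even hA].
by rewrite le_min hA hB.
Qed.
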